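(* Let $p\in[0,1]$, $q=1-p$, let $(x_j)_{j\ge1}$ be independent and identically distributed $\mathrm{Bern}(p)$ random variables, and let $\mathcal T_n^{\mathrm B}=\mathcal T_n^{\mathrm B}(x_1,\ldots,x_n)$ be the associated simple butterfly tree. With $$\mu_p=\frac{pq}{1-pq},\qquad \sigma_p^2=\frac{pq\,(1-3pq-2p^2q^2)}{(1-pq)^3},$$ we have $$\frac{\operatorname{HS}(\mathcal T_n^{\mathrm B})-\mu_p n}{\sqrt n}\Longrightarrow\mathcal N(0,\sigma_p^2)\quad\text{as } n\to\infty.$$
   Context: A rooted binary tree is a finite nonempty rooted tree in which each node has at most one left child and at most one right child. The Horton--Strahler (HS) number of a node $v$ is: $0$ if $v$ has no children; the HS number of the child if $v$ has exactly one child; and $\max(\operatorname{HS}(v_\ell),\operatorname{HS}(v_r))+\mathbf 1_{\{\operatorname{HS}(v_\ell)=\operatorname{HS}(v_r)\}}$ if $v$ has children $v_\ell,v_r$. $\operatorname{HS}(\mathcal T)$ is the HS number of the root of $\mathcal T$. $\mathcal T_1\oplus\mathcal T_2$ is obtained by making the root of $\mathcal T_2$ the right child of the last node of the path from the root of $\mathcal T_1$ that always moves to the right child; $\mathcal T_1\ominus\mathcal T_2$ is obtained by making the root of $\mathcal T_2$ the left child of the last node of the path from the root of $\mathcal T_1$ that always moves to the left child. Simple butterfly trees: for a bitstring $\mathbf x=(x_1,\ldots,x_n)\in\{0,1\}^n$, the simple butterfly tree $\mathcal T_n^{\mathrm B}(\mathbf x)$, with $2^n$ nodes, is defined recursively: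 $\mathcal T_0^{\mathrm B}$ (empty string) is a single node, and with $\mathcal S=\mathcal T_{n-1}^{\mathrm B}(x_1,\ldots,x_{n-1})$, $\mathcal T_n^{\mathrm B}(\mathbf x)$ is $\mathcal S\oplus\mathcal S$ if $x_n=0$ and $\mathcal S\ominus\mathcal S$ if $x_n=1$ (two identical copies of $\mathcal S$). $\Longrightarrow$ denotes convergence in distribution, and $\mathcal N(0,0)$ is the point mass at $0$. *)

(* Defs.v *)
From HB Require Import structures.
From mathcomp Require Import all_boot all_order all_algebra finmap.
From mathcomp Require Import all_classical all_reals all_analysis.

Set Implicit Arguments.
Unset Strict Implicit.
Unset Printing Implicit Defensive.
Import Order.TTheory GRing.Theory Num.Theory.
Import numFieldNormedType.Exports.
Local Open Scope classical_set_scope.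
Local Open Scope ring_scope.

(* Nonempty by construction: one constructor for each set of children. *)
Inductive btree : Type :=
  | TLeaf
  | TLeft of btree
  | TRight of btree
  | TNode of btree & btree.

Fixpoint HS (t : btree) : nat :=
  match t with
  | TLeaf => 0
  | TLeft l => HS l
  | TRight r => HS r
  | TNode l r => (maxn (HS l) (HS r) + (HS l == HS r))%N
  end.

Fixpoint oplus (t1 t2 : btree) : btree :=
  match t1 with
  | TLeaf => TRight t2
  | TLeft l => TNode l t2
  | TRight r => TRight (oplus r t2)
  | TNode l r => TNode l (oplus r t2)
  end.

Fixpoint ominus (t1 t2 : btree) : btree :=
  match t1 with
  | TLeaf => TLeft t2
  | TLeft l => TLeft (ominus l t2)
  | TRight r => TNode t2 r
  | TNode l r => TNode (ominus l t2) r
  end.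

(* The bit [true] stands for 1; [foldl] reads the bits from x_1 to x_n, so
   that x_n governs the join at the root, see [butterfly_rcons]. *)
Definition butterfly (x : seq bool) : btree :=
  foldl (fun t b => if b then ominus t t else oplus t t) TLeaf x.

Lemma butterfly_rcons (x : seq bool) (b : bool) :
  butterfly (rcons x b) =
    if b then ominus (butterfly x) (butterfly x)
    else oplus (butterfly x) (butterfly x).
Proof. by rewrite /butterfly foldl_rcons. Qed.

Definition independent_RVs d d' (T : measurableType d) (T' : measurableType d')
    (R : realType) (P : probability T R) (I : choiceType)
    (X : I -> {RV P >-> T'}) : Prop :=
  forall (J : {fset I}) (B : I -> set T'), (forall i, measurable (B i)) ->
    P (\bigcap_(i in [set` J]) (X i @^-1` B i)) =
    (\prod_(i <- J) P (X i @^-1` B i))%E.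

Arguments independent_RVs {d d' T T' R} P {I} X.

(* The sequence [X] is indexed from 0: [X j] is the bit x_(j+1). *)
Definition HS_butterfly d (T : measurableType d) (R : realType)
    (P : probability T R) (X : nat -> {RV P >-> bool}) (n : nat) (w : T) : nat :=
  HS (butterfly (mkseq (fun j => X j w) n)).

Definition HS_mean (R : realType) (p : R) : R :=
  let q := 1 - p in p * q / (1 - p * q).

Definition HS_var (R : realType) (p : R) : R :=
  let q := 1 - p in
  p * q * (1 - 3 * p * q - 2 * p ^+ 2 * q ^+ 2) / (1 - p * q) ^+ 3.

Definition HS_normalized d (T : measurableType d) (R : realType)
    (P : probability T R) (X : nat -> {RV P >-> bool}) (m : R) (n : nat) : T -> R :=
  fun w => ((HS_butterfly X n w)%:R - m * n%:R) / Num.sqrt n%:R.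

Lemma measurable_fun_bits d (T : measurableType d) (R : realType)
    (P : probability T R) (X : nat -> {RV P >-> bool}) (n : nat)
    (g : seq bool -> R) :
  measurable_fun setT (fun w => g (mkseq (fun j => X j w) n)).
Proof.
elim: n g => [|n IHn] g; first exact: (@measurable_cst _ _ _ _ setT (g [::])).
rewrite (_ : (fun w => _) = fun w =>
  if X n w then g (rcons (mkseq (fun j => X j w) n) true)
  else g (rcons (mkseq (fun j => X j w) n) false)); last first.
  by apply/funext => w; rewrite /mkseq -addn1 iotaD map_cat cats1; case: (X n w).
apply: measurable_fun_ifT => //.
- exact: (IHn (fun s => g (rcons s true))).
- exact: (IHn (fun s => g (rcons s false))).
Qed.

Lemma measurable_HS_normalized d (T : measurableType d) (R : realType)
    (P : probability T R) (X : nat -> {RV P >-> bool}) (m : R) (n : nat) :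
  measurable_fun setT (HS_normalized X m n).
Proof.
exact: (measurable_fun_bits X n
  (fun s => ((HS (butterfly s))%:R - m * n%:R) / Num.sqrt n%:R)).
Qed.

HB.instance Definition _ d (T : measurableType d) (R : realType)
    (P : probability T R) (X : nat -> {RV P >-> bool}) (m : R) (n : nat) :=
  isMeasurableFun.Build _ _ _ _ (HS_normalized X m n)
    (measurable_HS_normalized X m n).

(* N(m, v), parametrized by the variance [v >= 0].  The case v = 0 is separate
   because [normal_prob m 0] is the uniform law on [0, 1], not the point mass. *)
Definition gaussian (R : realType) (m v : R) :
    probability (measurableTypeR R) R :=
  if v == 0 then @dirac _ (measurableTypeR R) m R : probability _ R
  else normal_prob m (Num.sqrt v) : probability (measurableTypeR R) R.

(* Convergence of the distribution functions at the continuity points of the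
   limiting distribution function. *)
Definition cvg_in_distribution d (T : measurableType d) (R : realType)
    (P : probability T R) (Y : nat -> {RV P >-> R})
    (nu : probability (measurableTypeR R) R) : Prop :=
  let F := fun x : R => nu `]-oo, x]%classic in
  forall x : R, {for x, continuous F} -> cdf (Y n) x @[n --> \oo] --> F x.

Arguments cvg_in_distribution {d T R} P Y nu.

(* Main.v *)
(** Reading the bits from left to right, the HS number follows a three-state
   chain: from the balanced state the first bit fixes a direction, further equal
   bits change nothing, and the first opposite bit increments the HS number and
   returns to the balanced state. The central limit theorem for this additive
   functional is proved for the test functions Phi ((a - x) / eps), with Phi the
   standard normal distribution function: started from such a function, the heat
   flow is the explicit function Phi (y / sqrt v), so adding to it the first and
   second order correctors given by two Poisson equations of the chain yields a
   quantity whose conditional mean changes by O(n^(-3/2)) in one step. Summing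
   over n steps gives E Phi ((a - W_n) / eps) -> Phi (a / sqrt (eps^2 + sigma^2)),
   and eps = del^2, with a shifted by +-del, sandwiches the indicator of x <= a. *)

Require Import Defs.
From HB Require Import structures.
From mathcomp Require Import all_boot all_order all_algebra finmap.
From mathcomp Require Import all_classical all_reals all_analysis.
From mathcomp Require Import zify ring lra.
Import Order.TTheory GRing.Theory Num.Theory.
Import numFieldNormedType.Exports.
Local Open Scope classical_set_scope.
Local Open Scope ring_scope.
Set Implicit Arguments.
Unset Strict Implicit.
Unset Printing Implicit Defensive.

(** * The Horton-Strahler number as a three-state chain *)

Definition join (b : bool) (t u : btree) : btree :=
  if b then ominus t u else oplus t u.

(* The spine is the one along which [join b] descends in [t]; the HS numbers of
   the subtrees hanging off it are compared with [h]. *)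
Fixpoint spine_lt (b : bool) (h : nat) (t : btree) : bool :=
  match t with
  | TLeaf => true
  | TLeft l => if b then spine_lt b h l else (HS l < h)%N
  | TRight r => if b then (HS r < h)%N else spine_lt b h r
  | TNode l r =>
      if b then (HS r < h)%N && spine_lt b h l
      else (HS l < h)%N && spine_lt b h r
  end.

Definition root_child (b : bool) (t : btree) : option btree :=
  match t with
  | TLeaf => None
  | TLeft l => if b then Some l else None
  | TRight r => if b then None else Some r
  | TNode l r => Some (if b then l else r)
  end.


Lemma spine_lt_HS b h t : (HS t < h)%N -> spine_lt b h t.
Proof.
by case: b; elim: t => //= l IHl r IHr lt_h; rewrite ?IHl ?IHr ?andbT //; lia.
Qed.

(** Going up from the graft, every node of the spine compares [h] with a strictly smaller HS number,
    so the value [h] reaches the root unchanged. *)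
Lemma HS_join b h t u : spine_lt b h t -> HS u = h -> HS (join b t u) = h.
Proof.
case: b => + uh.
- elim: t => //= [r _|l IHl r _]; first by rewrite uh; lia.
  by move=> /andP[rh /IHl ->]; lia.
- elim: t => //= [l _|l _ r IHr]; first by rewrite uh; lia.
  by move=> /andP[lh /IHr ->]; lia.
Qed.

Lemma spine_lt_join b h t u :
  spine_lt b h t -> spine_lt b h u -> spine_lt b h (join b t u).
Proof.
case: b => + uh.
- by elim: t => //= [r _ ->|l IHl r _ /andP[-> /IHl]].
- by elim: t => //= [l _ ->|l _ r IHr /andP[-> /IHr]].
Qed.

(* The first component is the HS number.  In state [Some b] a join in direction
   [~~ b] increments it; in state [None] neither join does. *)
Definition HS_step (s : nat * option bool) (b : bool) : nat * option bool :=
  match s.2 with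
  | None => (s.1, Some b)
  | Some c => if b == c then s else (s.1.+1, None)
  end.

Definition HS_state (x : seq bool) : nat * option bool :=
  foldl HS_step (0%N, None) x.

(** Records what the next join meets. The spine condition makes a join in that direction neutral; in
    state [Some b] the root child on side [b] already has the full HS number, so a join on the other
    side creates a tie at the root. *)
Definition HS_inv (s : nat * option bool) (t : btree) : Prop :=
  HS t = s.1 /\
  match s.2 with
  | None => forall b, spine_lt b s.1 t
  | Some b => spine_lt b s.1 t /\ omap HS (root_child b t) = Some s.1
  end.

(** The new root child on side [b] is [t] itself or the join of the old child with [t]; in both
    cases its HS number is [n], by [HS_join] in the second. *)
Lemma HS_inv_join_same b n t : HS t = n -> spine_lt b n t ->
  HS_inv (n, Some b) (join b t t).
Proof.
move=> tn lt_n; split=> /=; first exact: HS_join.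
split; first exact: spine_lt_join.
case: b lt_n; case: t tn => [|l|r|l r] /= tn; rewrite ?tn //.
- by move=> lt_n; rewrite -[ominus _ _]/(join true l (TLeft l)) (HS_join lt_n).
- by case/andP=> _ lt_n; rewrite -[ominus _ _]/(join true l (TNode l r)) (HS_join lt_n).
- by move=> lt_n; rewrite -[oplus _ _]/(join false r (TRight r)) (HS_join lt_n).
- by case/andP=> _ lt_n; rewrite -[oplus _ _]/(join false r (TNode l r)) (HS_join lt_n).
Qed.

(** The old child on side [b] and the child that receives the graft both have HS number [n]. Their
    tie gives [n.+1] at the root, and since nothing below the root exceeds [n], the spine condition
    holds on both sides. *)
Lemma HS_inv_join_switch b n t : HS_inv (n, Some b) t ->
  HS_inv (n.+1, None) (join (~~ b) t t).
Proof.
case=> /= tn [lt_n]; have ltS c u : HS u = n -> spine_lt c n.+1 u.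
  by move=> un; apply: spine_lt_HS; rewrite un.
case: b lt_n => /= lt_n.
- case: t tn lt_n => //= [l|l r] tn.
    move=> _ [ln]; split=> [|[]] /=; rewrite ?tn ?ln ?ltnSn ?ltS //; lia.
  case/andP=> rn _ [ln].
  have jn : HS (oplus r (TNode l r)) = n.
    by apply: (@HS_join false) => //; apply: spine_lt_HS.
  by split=> [|[]] /=; rewrite ?jn ?ln ?ltnSn ?ltS //; lia.
- case: t tn lt_n => //= [r|l r] tn.
    move=> _ [rn]; split=> [|[]] /=; rewrite ?tn ?rn ?ltnSn ?ltS //; lia.
  case/andP=> ln _ [rn].
  have jn : HS (ominus l (TNode l r)) = n.
    by apply: (@HS_join true) => //; apply: spine_lt_HS.
  by split=> [|[]] /=; rewrite ?jn ?rn ?ltnSn ?ltS //; lia.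
Qed.

Lemma HS_inv_join s b t : HS_inv s t -> HS_inv (HS_step s b) (join b t t).
Proof.
case: s => n [c|] inv; rewrite /HS_step /=; last first.
  by case: inv => tn lt_n; apply: HS_inv_join_same.
case: eqP => [-> | /eqP]; first by case: inv => tn [lt_n _]; apply: HS_inv_join_same.
by move=> bc; have -> : b = ~~ c by [case: b c bc {inv} => [] []];
  apply: HS_inv_join_switch.
Qed.

Lemma HS_inv_butterfly x : HS_inv (HS_state x) (butterfly x).
Proof.
elim/last_ind: x => [|x b IHx]; first by split => // -[].
rewrite /HS_state foldl_rcons -/(HS_state x) butterfly_rcons.
exact: HS_inv_join.
Qed.

Lemma HS_butterflyE x : HS (butterfly x) = (HS_state x).1.
Proof. by case: (HS_inv_butterfly x). Qed.

(** * Means over independent bits *)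

(** The recursion splits off the last bit, so that one unfolding is one step of the chain. *)
Fixpoint bits_mean (R : realType) (p : R) (n : nat) (F : seq bool -> R) : R :=
  if n is m.+1 then
    p * bits_mean p m (fun s => F (rcons s true)) +
    (1 - p) * bits_mean p m (fun s => F (rcons s false))
  else F [::].

Section BitsMean.
Context (R : realType) (p : R).
Implicit Types F G : seq bool -> R.

Lemma bits_meanD n F G : bits_mean p n (fun s => F s + G s) =
  bits_mean p n F + bits_mean p n G.
Proof. by elim: n F G => //= n IHn F G; rewrite !IHn; ring. Qed.

Lemma bits_meanZ n c F : bits_mean p n (fun s => c * F s) =
  c * bits_mean p n F.
Proof. by elim: n F => //= n IHn F; rewrite !IHn; ring. Qed.

Lemma bits_mean_cst n c : bits_mean p n (fun=> c) = c.
Proof. by elim: n => //= n ->; ring. Qed.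

Hypotheses (p_ge0 : 0 <= p) (p_le1 : p <= 1).

Lemma ler_bits_mean n F G : (forall s, F s <= G s) ->
  bits_mean p n F <= bits_mean p n G.
Proof.
elim: n F G => //= n IHn F G FG.
by rewrite lerD// ler_wpM2l ?subr_ge0// IHn.
Qed.

Lemma bits_mean_ge0 n F : (forall s, 0 <= F s) -> 0 <= bits_mean p n F.
Proof. by rewrite -[X in X <= _](bits_mean_cst n 0); exact: ler_bits_mean. Qed.

Lemma ler_bits_mean_dist n F G c : (forall s, `|F s - G s| <= c) ->
  `|bits_mean p n F - bits_mean p n G| <= c.
Proof.
move=> FG; have {FG} FG s : G s - c <= F s <= G s + c.
  by rewrite -ler_distl.
rewrite ler_distl; apply/andP; split.
  rewrite -(bits_mean_cst n (- c)) -bits_meanD.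
  by apply: ler_bits_mean => s; have /andP[] := FG s.
rewrite -[X in _ + X](bits_mean_cst n) -bits_meanD.
by apply: ler_bits_mean => s; have /andP[] := FG s.
Qed.

End BitsMean.

(** * Law of the first bits of an independent Bernoulli sequence *)

Section BitsProbability.
Context d (T : measurableType d) (R : realType) (P : probability T R) (p : R).
Variable X : nat -> {RV P >-> bool}.
Hypotheses (p_ge0 : 0 <= p) (p_le1 : p <= 1).
Hypothesis X_bernoulli : forall j, distribution P (X j) =1 bernoulli_prob p.
Hypothesis X_indep : independent_RVs P X.

Let bits n w := mkseq (fun j => X j w) n.

Lemma measurable_bits n (A : pred (seq bool)) :
  measurable [set w | A (bits n w)].
Proof.
have mf := measurable_fun_bits X n (fun s => (A s)%:R : R).
have -> : [set w | A (bits n w)] =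
    (fun w => (A (bits n w))%:R : R) @^-1` [set 1].
  apply/seteqP; split=> w /=; first by move=> ->.
  by case: (A _) => //= /esym/eqP; rewrite oner_eq0.
by rewrite -[_ @^-1` _]setTI; apply: mf.
Qed.

Lemma probability_bit j b :
  P (X j @^-1` [set b]) = (if b then p else 1 - p)%:E.
Proof.
have /= := X_bernoulli j [set b]; rewrite /distribution /pushforward /= => ->.
rewrite /bernoulli_prob p_ge0 p_le1 /= fsbig_set1 //.
Qed.

(** The cylinder over later indices makes the induction work: each step moves the last bit of the
    prefix into the cylinder, and independence is applied once the prefix is empty. *)
Lemma probability_bits_cylinder n (A : pred (seq bool)) (J : {fset nat})
    (b : nat -> bool) : (forall j, j \in J -> n <= j)%N ->
  P ([set w | A (bits n w)] `&` \bigcap_(j in [set` J]) (X j @^-1` [set b j])) =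
  ((bits_mean p n (fun s => (A s)%:R))%:E * \prod_(j <- J) P (X j @^-1` [set b j]))%E.
Proof.
have mC (K : {fset nat}) c : measurable (\bigcap_(j in [set` K]) (X j @^-1` [set c j])).
  apply: fin_bigcap_measurable => [|j _]; last exact: measurable_funPTI.
  exact: finite_fset.
elim: n A J b => [|n IHn] A J b nJ.
  rewrite /bits /=; have [A0|A0] := boolP (A [::]).
    rewrite mul1e -X_indep //; congr (P _); apply/seteqP; split=> [w []//|w Cw].
    by split.
  rewrite mul0e (_ : _ `&` _ = set0) ?measure0 //.
  by apply/seteqP; split=> // w [].
pose b' c j := if j == n then c else b j.
have nJ' : n \notin J by apply/negP => /nJ; rewrite ltnn.
have step c : P ([set w | A (rcons (bits n w) c)] `&`
    \bigcap_(j in [set` (n |` J)%fset]) (X j @^-1` [set b' c j])) =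
  ((if c then p else 1 - p)%:E *
   ((bits_mean p n (fun s => (A (rcons s c))%:R))%:E *
    \prod_(j <- J) P (X j @^-1` [set b j])))%E.
  rewrite (IHn (fun s => A (rcons s c))); last first.
    by move=> j; rewrite !inE => /predU1P[-> //|/nJ]; exact: ltnW.
  rewrite big_fsetU1 //= /b' eqxx probability_bit muleCA; congr (_ * (_ * _))%E.
  by apply: eq_big_seq => j /nJ; case: eqP => // ->; rewrite ltnn.
have bitsS w : bits n.+1 w = rcons (bits n w) (X n w).
  by rewrite /bits /mkseq -addn1 iotaD map_cat cats1.
have stepE c : [set w | A (rcons (bits n w) c)] `&`
    \bigcap_(j in [set` (n |` J)%fset]) (X j @^-1` [set b' c j]) =
  ([set w | A (bits n.+1 w)] `&` \bigcap_(j in [set` J]) (X j @^-1` [set b j]))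
    `&` X n @^-1` [set c].
  apply/seteqP; split=> w /=.
    case=> Aw Cw; have Xn : X n w = c.
      by have := Cw n; rewrite /b' /= eqxx; apply; rewrite !inE eqxx.
    split=> //; rewrite bitsS Xn; split=> // j /= jJ.
    have := Cw j; rewrite /b' /=; case: eqP => [jn|_]; last first.
      by apply; rewrite !inE jJ orbT.
    by move: jJ nJ'; rewrite jn => ->.
  case=> -[+ Cw] Xn; rewrite bitsS Xn => Aw; split=> // j /=.
  rewrite !inE /b'; case: eqP => [-> _ //|_ /= jJ]; exact: Cw.
pose D c := [set w | A (rcons (bits n w) c)] `&`
  \bigcap_(j in [set` (n |` J)%fset]) (X j @^-1` [set b' c j]).
have mD c : measurable (D c).
  by apply: measurableI; [exact: (@measurable_bits n (fun s => A (rcons s c)))|exact: mC].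
(* The event splits into two disjoint parts according to the value of bit [n]. *)
transitivity (P (D true `|` D false)).
  congr (P _); rewrite /D !stepE -setIUr -[LHS]setIT; congr (_ `&` _).
  by apply/seteqP; split=> // w _ /=; case: (X n w); [left|right].
rewrite measureU //; last first.
  by rewrite /D !stepE; apply/seteqP; split=> // w [[_ /= ->] []].
rewrite [LHS](_ : _ = P (D true) + P (D false))%E // /D !step.
rewrite !muleA -ge0_muleDl.
- by rewrite -!EFinM -EFinD.
- by rewrite -EFinM lee_fin mulr_ge0 // bits_mean_ge0.
- by rewrite -EFinM lee_fin mulr_ge0 ?subr_ge0 // bits_mean_ge0.
Qed.

Lemma probability_bits n (A : pred (seq bool)) :
  P [set w | A (bits n w)] = (bits_mean p n (fun s => (A s)%:R))%:E.
Proof.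
have := @probability_bits_cylinder n A fset0 (fun=> true).
rewrite big_seq_fset0 mule1 => <- //; congr (P _).
by apply/seteqP; split=> [w Aw|w []//]; split.
Qed.

End BitsProbability.

(** * The normal distribution function *)

Section NormalCdf.
Context (R : realType).
Implicit Types (s x y z : R).

(** Here [s] is the standard deviation, whereas [gaussian] takes the variance. *)
Definition normal_cdf s x : R := fine (normal_prob 0 s `]-oo, x]).

Lemma normal_cdfE s x : (normal_cdf s x)%:E = normal_prob 0 s `]-oo, x].
Proof. by rewrite /normal_cdf fineK // fin_num_measure. Qed.

Lemma is_derive_normal_cdf s x : s != 0 ->
  is_derive x 1 (normal_cdf s) (normal_pdf 0 s x).
Proof.
move=> s0; have [] := @continuous_FTC1 R (normal_pdf 0 s) -oo%O x (x + 1).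
- by rewrite ltrDl.
- by apply: (integrableS _ _ (subsetT _)) => //; exact: integrable_normal_pdf.
- by rewrite ltNyr.
- by have := continuous_normal_pdf (m := 0) s0; exact.
by move=> dF; rewrite derive1E => <-; exact: DeriveDef.
Qed.

Lemma normal_cdf_ge0 s x : 0 <= normal_cdf s x.
Proof. by rewrite fine_ge0. Qed.

Lemma normal_cdf_le1 s x : normal_cdf s x <= 1.
Proof. by rewrite -lee_fin normal_cdfE probability_le1. Qed.

Lemma normal_cdf_ndecr s : {homo normal_cdf s : x y / x <= y}.
Proof.
by move=> x y xy; rewrite -lee_fin !normal_cdfE le_measure ?inE//; exact: subitvPr.
Qed.

(** The identity is a random variable with the normal law, so the general limits of distribution
    functions at infinity apply to [normal_cdf]. *)
Let idR : measurableTypeR R -> R := idfun.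

#[local] HB.instance Definition _ :=
  @isMeasurableFun.Build _ _ _ _ idR (@measurable_id _ _ setT).

Let cdf_idR s : cdf (idR : {RV (normal_prob 0 s) >-> R}) = EFin \o normal_cdf s.
Proof. by apply/funext => x /=; rewrite normal_cdfE. Qed.

Lemma cvg_normal_cdfy1 s : normal_cdf s x @[x --> +oo] --> (1 : R).
Proof.
by have := cvg_cdfy1 (idR : {RV (normal_prob 0 s) >-> R}); rewrite cdf_idR => /fine_cvg.
Qed.

Lemma cvg_normal_cdfNy0 s : normal_cdf s x @[x --> -oo] --> (0 : R).
Proof.
by have := cvg_cdfNy0 (idR : {RV (normal_prob 0 s) >-> R}); rewrite cdf_idR => /fine_cvg.
Qed.

Lemma normal_pdf_std z : normal_pdf 0 1 z =
  normal_peak 1 * expR (- (z ^+ 2 / 2)) :> R.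
Proof.
by rewrite normal_pdfE ?oner_eq0 // /normal_fun subr0 expr1n mulNr.
Qed.

(** The difference of the two sides has zero derivative, hence is constant, and it tends to 0 at
    [-oo]. *)
Lemma normal_cdf_scale s x : 0 < s -> normal_cdf s x = normal_cdf 1 (x / s).
Proof.
move=> s0.
pose f y := normal_cdf s y - normal_cdf 1 (y / s).
have df y : is_derive y 1 f 0.
  have d1 := is_derive_normal_cdf y (lt0r_neq0 s0).
  have d2 := is_derive_normal_cdf (y / s) (oner_neq0 R).
  have d3 : is_derive y (1:R) (fun y : R => y / s) s^-1.
    have -> : (fun y : R => y / s) = s^-1 \*: id.
      by apply/funext => t; rewrite /= mulrC.
    by apply: is_derive_eq; rewrite /GRing.scale /= mulr1.
  have d4 := is_derive1_comp (g := fun y : R => y / s) d2 d3.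
  apply: (is_derive_eq (is_deriveB d1 d4)).
  rewrite normal_pdf_std normal_pdfE ?lt0r_neq0 // /normal_peak /normal_fun.
  rewrite subr0 expr1n mul1r -mulrnAr sqrtrM ?sqr_ge0 // sqrtr_sqr gtr0_norm //.
  have -> : - y ^+ 2 / (s ^+ 2 *+ 2) = - ((y / s) ^+ 2 / 2).
    by rewrite expr_div_n; field; rewrite lt0r_neq0.
  by rewrite invfM; ring.
have f0 : f y @[y --> -oo] --> (0 : R).
  rewrite -[X in _ --> X](subr0 (0 : R)); apply: cvgB; first exact: cvg_normal_cdfNy0.
  have : (fun y : R => y / s) @ -oo --> -oo.
    by apply: gt0_cvgMlNy; rewrite ?invr_gt0.
  by move=> /cvg_comp; apply; exact: cvg_normal_cdfNy0.
have fx : f x = 0.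
  have: f y @[y --> -oo] --> f x.
    rewrite (_ : f = cst (f x)); first exact: cvg_cst.
    by apply/funext => y; apply: is_derive_0_is_cst.
  by move/cvg_unique; apply.
by move/eqP: fx; rewrite subr_eq0 => /eqP.
Qed.

End NormalCdf.

(** * Heat flow of the normal distribution function *)

Section HeatKernel.
Context (R : realType).
Implicit Types (v x y z C : R) (j k : nat).

(* The [j]-th derivative of the standard normal distribution function, by the
   recurrence of the Hermite functions. *)
Fixpoint normal_cdfn j z : R :=
  match j with
  | 0 => normal_cdf 1 z
  | i.+1 => match i with
            | 0 => normal_pdf 0 1 z
            | k.+1 => - (k%:R * normal_cdfn k z + z * normal_cdfn i z)
            end
  end.

Lemma normal_cdfnSS j z : normal_cdfn j.+2 z =
  - (j%:R * normal_cdfn j z + z * normal_cdfn j.+1 z).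
Proof. by []. Qed.

Arguments normal_cdfn : simpl never.

Lemma normal_cdfn1 z : normal_cdfn 1 z = normal_peak 1 * expR (- (z ^+ 2 / 2)).
Proof. exact: normal_pdf_std. Qed.

(** The induction carries two consecutive orders, because differentiating the recurrence involves
    both. *)
Lemma is_derive_normal_cdfn j z :
  is_derive z 1 (normal_cdfn j) (normal_cdfn j.+1 z).
Proof.
suff : is_derive z 1 (normal_cdfn j) (normal_cdfn j.+1 z) /\
       is_derive z 1 (normal_cdfn j.+1) (normal_cdfn j.+2 z) by case.
elim: j => [|j [IHj IHj1]].
  split; first by exact: (is_derive_normal_cdf _ (oner_neq0 R)).
  have -> : normal_cdfn 1 = normal_peak 1 \*: (expR \o (fun z : R => - (z ^+ 2 / 2))).
    by apply/funext => t; rewrite normal_cdfn1.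
  have d1 : is_derive z 1 (fun z : R => - (z ^+ 2 / 2)) (- z).
    have -> : (fun z : R => - (z ^+ 2 / 2)) = (- 2^-1) \*: (id ^+ 2).
      by apply/funext => t /=; rewrite exprfctE /GRing.scale /= mulNr mulrC.
    by apply: is_derive_eq; rewrite /GRing.scale /= expr1; field.
  apply: (is_derive_eq (is_deriveZ _ (is_derive1_comp _ d1))).
  rewrite [RHS](normal_cdfnSS 0).
  by rewrite normal_cdfn1 /GRing.scale /=; ring.
split=> //.
have -> : normal_cdfn j.+2 =
    - (j%:R \*: normal_cdfn j + id * normal_cdfn j.+1).
  by apply/funext => t; rewrite normal_cdfnSS.
apply: is_derive_eq.
by rewrite [RHS]normal_cdfnSS /GRing.scale /= -[j.+1%:R]natr1; ring.
Qed.

(** The recurrence multiplies by [z], so boundedness passes to the next order only if all powers of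
    [z] are controlled at once. *)
Lemma normal_cdfn_decay j k : exists C, forall z,
  `|z ^+ k * normal_cdfn j.+1 z| <= C.
Proof.
suff H i : (forall k, exists C, forall z, `|z ^+ k * normal_cdfn i.+1 z| <= C) /\
     (forall k, exists C, forall z, `|z ^+ k * normal_cdfn i.+2 z| <= C) by have [] := H j.
elim: i {j k} => [|i [IHi IHi1]].
  have pdf_decay k : exists C, forall z, `|z ^+ k * normal_cdfn 1 z| <= C.
    (* With [t = z ^+ 2 / 2], the constant comes from [|z| ^+ k <= 1 + (2 * t) ^+ k.+1] and from
       bounding [t ^+ k.+1 / k.+1!] by [expR t]. *)
    exists (normal_peak 1 * (1 + k.+1`!%:R * 2 ^+ k.+1)) => z.
    rewrite normal_cdfn1; set t := z ^+ 2 / 2.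
    have t0 : 0 <= t by rewrite divr_ge0 ?sqr_ge0.
    have zk : `|z ^+ k| <= (1 + k.+1`!%:R * 2 ^+ k.+1) * expR t.
      rewrite mulrDl mul1r; apply: (@le_trans _ _ (1 + (z ^+ 2) ^+ k.+1)).
        rewrite normrX -real_normK ?num_real // -exprM; have [z1|/ltW z1] := leP `|z| 1.
          by rewrite -[leLHS]addr0 lerD ?exprn_ile1 ?exprn_ge0.
        rewrite -[leLHS]add0r lerD // ler_weXn2l //; lia.
      apply: lerD; first by rewrite (le_trans _ (expR_ge1Dx t)) // lerDl.
      rewrite (_ : z ^+ 2 = 2 * t); last by rewrite /t; field.
      rewrite exprMn mulrAC [leLHS]mulrC ler_wpM2r ?exprn_ge0 //.
      rewrite mulrC -ler_pdivrMr ?ltr0n ?fact_gt0 //.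
      by rewrite (le_trans _ (expR_ge1Dxn k t0)) // lerDr.
    rewrite normrM [X in _ * X]ger0_norm ?mulr_ge0 ?normal_peak_ge0 ?expR_ge0 //.
    rewrite mulrCA ler_wpM2l ?normal_peak_ge0 // expRN.
    by rewrite -ler_pdivlMr ?invr_gt0 ?expR_gt0 // invrK.
  split=> // k; have [C HC] := pdf_decay k.+1; exists C => z.
  by rewrite normal_cdfnSS mul0r add0r mulrN normrN mulrA -exprSr.
split=> // k; have [C1 H1] := IHi k; have [C2 H2] := IHi1 k.+1.
exists (i.+1%:R * C1 + C2) => z.
rewrite normal_cdfnSS mulrN normrN mulrDr.
rewrite (le_trans (ler_normD _ _)) // lerD //.
  by rewrite mulrCA normrM normr_nat ler_wpM2l.
by rewrite mulrA -exprSr.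
Qed.

Lemma normal_cdfn_bounded j : exists C, forall z, `|normal_cdfn j.+1 z| <= C.
Proof.
by have [C HC] := normal_cdfn_decay j 0; exists C => z; have := HC z; rewrite mul1r.
Qed.

(* [heat 0] solves the heat equation [2 * D_v u = D_y^2 u], and [heat j] is its
   [j]-th derivative in [y]. *)
Definition heat j v y : R :=
  (Num.sqrt v)^-1 ^+ j * normal_cdfn j ((Num.sqrt v)^-1 * y).

Lemma is_derive_heat_y j v y :
  is_derive y 1 (heat j v) (heat j.+1 v y).
Proof.
set w := (Num.sqrt v)^-1.
have d1 : is_derive y 1 (fun y : R => w * y) w.
  have -> : (fun y : R => w * y) = w \*: id by [].
  by apply: is_derive_eq; rewrite /GRing.scale /= mulr1.
have := is_deriveZ (w ^+ j) (is_derive1_comp (g := fun y : R => w * y)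
  (is_derive_normal_cdfn j (w * y)) d1).
by move/is_derive_eq; apply; rewrite /heat -/w /GRing.scale /= exprSr; ring.
Qed.

(** With [w = v^(-1/2)] one has [w' = - w ^+ 3 / 2]; the product rule then produces the right-hand
    side of the recurrence [normal_cdfnSS], times [w ^+ j.+2 / 2]. *)
Lemma is_derive_heat_v j v y : 0 < v ->
  is_derive v 1 (fun v => heat j v y) (2^-1 * heat j.+2 v y).
Proof.
move=> v0; pose w v := (Num.sqrt v)^-1 : R.
have sv0 : Num.sqrt v != 0 by rewrite sqrtr_eq0 -ltNge.
have dw : is_derive v 1 w (- 2^-1 * w v ^+ 3).
  have d1 := is_derive1_sqrt v0.
  apply: (is_derive_eq (is_deriveV sv0 d1)).
  by rewrite /GRing.scale /= /w; field.
have d1 : is_derive v 1 (fun v => w v * y) (- 2^-1 * w v ^+ 3 * y).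
  have -> : (fun v => w v * y) = y \*: w by apply/funext => t /=; rewrite mulrC.
  by apply: is_derive_eq; rewrite /GRing.scale /= mulrC.
have d2 := is_derive1_comp (g := fun v => w v * y)
  (is_derive_normal_cdfn j (w v * y)) d1.
have d3 := is_deriveM (is_deriveX j dw) d2.
have -> : (fun v => heat j v y) =
    w ^+ j * (normal_cdfn j \o (fun v => w v * y)).
  by apply/funext => t; rewrite exprfctE.
apply: (is_derive_eq d3).
rewrite /heat -/(w v) normal_cdfnSS /GRing.scale /=.
rewrite exprfctE; case: j {d2 d3} => [|j] /=; first by field.
by rewrite -[j.+1%:R]natr1 !exprS; field.
Qed.

Lemma heat_bounded j v0 : 0 < v0 -> exists C, forall v y, v0 <= v ->
  `|heat j.+1 v y| <= C.
Proof.
move=> v00; have [C HC] := normal_cdfn_bounded j.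
exists ((Num.sqrt v0)^-1 ^+ j.+1 * C) => v y v0v.
rewrite normrM ler_pM // ger0_norm ?exprn_ge0 ?invr_ge0 ?sqrtr_ge0 //.
rewrite lerXn2r ?nnegrE ?invr_ge0 ?sqrtr_ge0 //.
by rewrite lef_pV2 ?posrE ?sqrtr_gt0 ?ler_wsqrtr // (lt_le_trans v00).
Qed.

End HeatKernel.

(** * Taylor estimates *)

Section Taylor.
Context (R : realType).

(** The endpoints are unordered, so that increments of either sign are covered. *)
Lemma MVT_norm_le (f df : R -> R) (a b B : R) :
  (forall x, Num.min a b <= x <= Num.max a b -> is_derive x 1 f (df x)) ->
  (forall x, Num.min a b <= x <= Num.max a b -> `|df x| <= B) ->
  `|f b - f a| <= B * `|b - a|.
Proof.
wlog ab : a b / a <= b => [H|].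
  have /orP[|ba] := le_total a b; first exact: H.
  by rewrite (minC a) (maxC a) (distrC (f b)) (distrC b); exact: H.
rewrite (min_idPl ab) (max_idPr ab).
move=> Df dfB; have [||c] := @MVT_segment R f df a b ab.
- by move=> x; rewrite in_itv /= => /andP[/ltW ax /ltW xb]; apply: Df; rewrite ax.
- apply: continuous_in_subspaceT => x; rewrite inE /= in_itv /= => xab.
  by apply/differentiable_continuous/derivable1_diffP; case: (Df x xab).
rewrite in_itv /= => cab ->.
by rewrite normrM ler_wpM2r // dfB.
Qed.

Variables (u : nat -> R -> R) (C : R).
Implicit Types (y h : R).
Hypothesis du : forall j y, is_derive y (1 : R) (u j) (u j.+1 y).

Lemma taylor1 j y h : (forall y, `|u j.+1 y| <= C) ->
  `|u j (y + h) - u j y| <= C * `|h|.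
Proof.
move=> uC; have := @MVT_norm_le _ _ y (y + h) C (fun x _ => du j x) (fun x _ => uC x).
by rewrite (addrAC y) subrr add0r.
Qed.

Let between y h x : Num.min y (y + h) <= x <= Num.max y (y + h) -> `|x - y| <= `|h|.
Proof.
have [h0|/ltW h0] := leP 0 h.
  rewrite min_l ?max_r ?lerDl // => /andP[yx xh].
  by rewrite !ger0_norm ?subr_ge0 //; lra.
rewrite min_r ?max_l ?gerDl // => /andP[yx xh].
by rewrite !ler0_norm ?subr_le0 //; lra.
Qed.

(** As a function of the endpoint, the remainder has as derivative the remainder of one order less.
    Using the mean value inequality instead of integrating leaves [C] in place of [C / 2]; [taylor3]
    repeats this. *)
Lemma taylor2 j y h : (forall y, `|u j.+2 y| <= C) ->
  `|u j (y + h) - u j y - h * u j.+1 y| <= C * `|h| ^+ 2.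
Proof.
move=> uC.
have D x : is_derive x (1 : R) (fun x => u j x - (x - y) * u j.+1 y)
    (u j.+1 x - u j.+1 y).
  have := is_deriveB (du j x) (is_deriveZ (u j.+1 y) (is_deriveB (is_derive_id x 1)
    (is_derive_cst y x 1))).
  rewrite [X in is_derive _ _ X _](_ : _ = fun x => u j x - (x - y) * u j.+1 y).
    by move/is_derive_eq; apply; rewrite /GRing.scale /=; ring.
  by apply/funext => t; rewrite /GRing.scale /= mulrC.
have := @MVT_norm_le _ _ y (y + h) (C * `|h|) (fun x _ => D x).
have e : y + h - y = h by ring.
rewrite e subrr mul0r subr0 -mulrA -expr2 => H.
rewrite addrAC; apply: H => x /between xh.
rewrite -[x](subrKC y).
apply: (le_trans (taylor1 _ _ uC)).
by rewrite ler_wpM2l // (le_trans _ (uC y)).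
Qed.

Lemma taylor3 j y h : (forall y, `|u j.+3 y| <= C) ->
  `|u j (y + h) - u j y - h * u j.+1 y - h ^+ 2 / 2 * u j.+2 y| <= C * `|h| ^+ 3.
Proof.
move=> uC.
pose g x := u j x - (x - y) * u j.+1 y - (x - y) ^+ 2 / 2 * u j.+2 y.
have D x : is_derive x (1 : R) g
    (u j.+1 x - u j.+1 y - (x - y) * u j.+2 y).
  have d1 := is_deriveB (is_derive_id x 1) (is_derive_cst y x 1).
  have := is_deriveB (is_deriveB (du j x) (is_deriveZ (u j.+1 y) d1))
    (is_deriveZ (u j.+2 y / 2) (is_deriveX 2 d1)).
  rewrite [X in is_derive _ _ X _](_ : _ = g).
    move/is_derive_eq; apply; rewrite /GRing.scale /= expr1.
    by rewrite (_ : (id - cst y) x = x - y) //; field.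
  apply/funext => t; transitivity (u j t - u j.+1 y * (t - y) - u j.+2 y / 2 * (t - y) ^+ 2).
    by [].
  by rewrite /g; field.
have := @MVT_norm_le _ _ y (y + h) (C * `|h| ^+ 2) (fun x _ => D x).
have e : y + h - y = h by ring.
rewrite /g e subrr expr0n /= !mul0r !subr0 => H.
rewrite (exprSr _ 2) mulrA.
rewrite (_ : _ - _ = u j (y + h) - h * u j.+1 y - h ^+ 2 / 2 * u j.+2 y - u j y); last by ring.
apply: H => x /between xh.
rewrite -[u j.+1 x](_ : u j.+1 (y + (x - y)) = _); last by rewrite subrKC.
apply: (le_trans (taylor2 _ _ uC)).
rewrite ler_wpM2l ?(le_trans _ (uC y)) //.
by rewrite lerXn2r ?nnegrE.
Qed.

End Taylor.

(** * One-step expansion of the corrected heat function *)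

Section HeatStep.
Context (R : realType) (v0 C : R).
Hypothesis v0_gt0 : 0 < v0.
Hypothesis heatC : forall j v y, (j < 4)%N -> v0 <= v -> `|heat j.+1 v y| <= C.
Implicit Types (j : nat) (v y r d g G M del : R).

Let C_ge0 : 0 <= C.
Proof. by rewrite (le_trans _ (@heatC 0 v0 0 _ _)). Qed.

Lemma heat_time1 j v y r : (j < 3)%N -> 0 <= r -> v0 <= v - r ->
  `|heat j (v - r) y - heat j v y| <= C * r.
Proof.
move=> j3 r0 vr.
have -> : C * r = C * `|v - r - v| by rewrite (addrAC v) subrr add0r normrN ger0_norm.
have vrv : v - r <= v by rewrite gerBl.
apply: (@MVT_norm_le R (fun v => heat j v y) (fun v => 2^-1 * heat j.+2 v y));
  rewrite (min_idPr vrv) => x /andP[/(le_trans vr) vx _].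
  by apply: is_derive_heat_v; exact: lt_le_trans vx.
rewrite normrM ger0_norm // -[leRHS]mul1r ler_pM // ?invf_le1 ?ler1n //.
exact: heatC.
Qed.

(** The derivative of the remainder in the variance is half an increment of [heat 2], which
    [heat_time1] bounds. *)
Lemma heat_time2 v y r : 0 <= r -> v0 <= v - r ->
  `|heat 0 (v - r) y - heat 0 v y + r / 2 * heat 2 v y| <= C * r ^+ 2.
Proof.
move=> r0 vr.
have vrv : v - r <= v by rewrite gerBl.
pose f x := heat 0 x y - (x - v) * (heat 2 v y / 2).
have D x : v0 <= x -> is_derive x (1 : R) f (2^-1 * (heat 2 x y - heat 2 v y)).
  move=> vx; have d0 := is_derive_heat_v 0 y (lt_le_trans v0_gt0 vx).
  have := is_deriveB d0 (is_deriveZ (heat 2 v y / 2)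
    (is_deriveB (is_derive_id x 1) (is_derive_cst v x 1))).
  rewrite [X in is_derive _ _ X _](_ : _ = f).
    by move/is_derive_eq; apply; rewrite /GRing.scale /=; field.
  apply/funext => t; transitivity (heat 0 t y - (heat 2 v y / 2) * (t - v)) => //.
  by rewrite /f; ring.
have := @MVT_norm_le R f _ v (v - r) (C * r) _ _.
rewrite (min_idPr vrv) (max_idPl vrv).
move=> /(_ (fun x => 2^-1 * (heat 2 x y - heat 2 v y))) H.
rewrite (_ : _ + _ = f (v - r) - f v); last by rewrite /f; field.
have -> : C * r ^+ 2 = C * r * `|v - r - v|.
  by rewrite (addrAC v) subrr add0r normrN ger0_norm // -mulrA.
apply: H => x /andP[vx xv]; first by apply: D; exact: le_trans vx.
rewrite normrM ger0_norm // -[leRHS]mul1r ler_pM // ?invf_le1 ?ler1n //.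
rewrite [x in heat 2 x y](_ : x = v - (v - x)); last by ring.
rewrite (le_trans (heat_time1 _ _ _ _)) //; first by rewrite subr_ge0.
  by rewrite subKr (le_trans vr).
by rewrite ler_wpM2l // lerBlDl -lerBlDr.
Qed.

(** [g] and [G] stand for the first and second order correctors at the current state. The minus sign
    appears because [y] decreases when the HS number grows. *)
Definition corrected_heat (del v y g G : R) : R :=
  heat 0 v y - del * g * heat 1 v y + del ^+ 2 * G * heat 2 v y.

(** Here [g] and [G] belong to the next state. The coefficients of [heat 1] and [heat 2] in the
    expansion are those averaged in [poisson_mean] and [poisson_var]. *)
Lemma corrected_heat_step del v y r d g G M :
  0 <= del -> del <= 1 -> 0 <= r -> v0 <= v - r * del ^+ 2 ->
  `|d| <= 1 -> `|g| <= M -> `|G| <= M ->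
  `|corrected_heat del (v - r * del ^+ 2) (y - del * d) g G -
    (heat 0 v y - del * (d + g) * heat 1 v y +
     del ^+ 2 * (d ^+ 2 / 2 + g * d + G - r / 2) * heat 2 v y)|
  <= C * (1 + r + r ^+ 2 + 2 * M * (1 + r)) * del ^+ 3.
Proof.
move=> del0 del1 r0 vr d1 gM GM.
have r2 : 0 <= r * del ^+ 2 by rewrite mulr_ge0 ?exprn_ge0.
have vv : v0 <= v by rewrite (le_trans vr) // gerBl.
have M0 : 0 <= M by rewrite (le_trans _ gM).
have hd : `|- (del * d)| <= del.
  by rewrite normrN normrM ger0_norm // -[leRHS]mulr1 ler_wpM2l.
have space j := @is_derive_heat_y R j v.
set v' := v - r * del ^+ 2; set y' := y - del * d.
(* [E1], [E4], [E6] are the errors of changing the variance; [E2], [E5], [E3] are the spatial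
   remainders for [heat 0], [heat 1], [heat 2], all bounded through [heat 3]. With its prefactor
   each contributes at most order [del ^+ 3]. *)
have [E1 E1E e1] : exists2 E, heat 0 v' y' =
    heat 0 v y' - r * del ^+ 2 / 2 * heat 2 v y' + E & `|E| <= C * (r * del ^+ 2) ^+ 2.
  eexists; last exact: (heat_time2 y' r2 vr); by rewrite /v'; ring.
have := taylor3 (u := fun j => heat j v) space y (- (del * d)) (fun y => @heatC 2 v y isT vv).
set E2 := (X in `|X|) => /le_trans e2; have {}e2 : `|E2| <= C * del ^+ 3.
  by apply: e2; rewrite ler_wpM2l // lerXn2r ?nnegrE.
have E2E : heat 0 v y' = heat 0 v y - del * d * heat 1 v y +
    del ^+ 2 * d ^+ 2 / 2 * heat 2 v y + E2 by rewrite /E2 /y'; field.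
have := taylor1 (u := fun j => heat j v) space y (- (del * d)) (fun y => @heatC 2 v y isT vv).
set E3 := (X in `|X|) => /le_trans e3; have {}e3 : `|E3| <= C * del.
  by apply: e3; rewrite ler_wpM2l.
have E3E : heat 2 v y' = heat 2 v y + E3 by rewrite /E3 /y'; ring.
have [E4 E4E e4] : exists2 E, heat 1 v' y' = heat 1 v y' + E & `|E| <= C * (r * del ^+ 2).
  by eexists; last exact: (heat_time1 (j := 1) y' isT r2 vr); rewrite /v'; ring.
have := taylor2 (u := fun j => heat j v) space y (- (del * d)) (fun y => @heatC 2 v y isT vv).
set E5 := (X in `|X|) => /le_trans e5; have {}e5 : `|E5| <= C * del ^+ 2.
  by apply: e5; rewrite ler_wpM2l // lerXn2r ?nnegrE.
have E5E : heat 1 v y' = heat 1 v y - del * d * heat 2 v y + E5.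
  by rewrite /E5 /y'; ring.
have [E6 E6E e6] : exists2 E, heat 2 v' y' = heat 2 v y' + E & `|E| <= C * (r * del ^+ 2).
  by eexists; last exact: (heat_time1 (j := 2) y' isT r2 vr); rewrite /v'; ring.
rewrite /corrected_heat E1E E2E E6E E4E E5E E3E.
rewrite [X in `|X|](_ : _ = E1 + E2 - r * del ^+ 2 / 2 * E3 - del * g * (E4 + E5)
  + del ^+ 2 * G * (E6 + E3)); last by field.
have nD (a b A B : R) : `|a| <= A -> `|b| <= B -> `|a + b| <= A + B :> R.
  by move=> aA bB; rewrite (le_trans (ler_normD _ _)) // lerD.
have nM (a b A B : R) : `|a| <= A -> `|b| <= B -> `|a * b| <= A * B :> R.
  by move=> aA bB; rewrite normrM ler_pM.
have nN (a A : R) : `|a| <= A -> `|- a| <= A :> R by rewrite normrN.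
have n1 (a : R) : 0 <= a -> `|a| <= a :> R by move=> a0; rewrite ger0_norm.
have e7 : `|r * del ^+ 2 / 2| <= r * del ^+ 2 / 2 by rewrite n1 // divr_ge0.
have e8 : `|del| <= del by exact: n1.
have e9 : `|del ^+ 2| <= del ^+ 2 by apply: n1; rewrite exprn_ge0.
apply: (le_trans (nD _ _ _ _ (nD _ _ _ _ (nD _ _ _ _ (nD _ _ _ _ e1 e2)
  (nN _ _ (nM _ _ _ _ e7 e3))) (nN _ _ (nM _ _ _ _ (nM _ _ _ _ e8 gM) (nD _ _ _ _ e4 e5))))
  (nM _ _ _ _ (nM _ _ _ _ e9 GM) (nD _ _ _ _ e6 e3)))).
(* The terms in [del ^+ 4] are absorbed using [del <= 1]; the remaining slack is a sum of
   nonnegative terms. *)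
have d3 : 0 <= C * del ^+ 3 by rewrite mulr_ge0 ?exprn_ge0.
have d43 : C * del ^+ 4 <= C * del ^+ 3.
  by rewrite ler_wpM2l // ler_wiXn2l.
rewrite -subr_ge0.
rewrite (_ : _ - _ =
  (C * del ^+ 3 - C * del ^+ 4) * (r ^+ 2 + M * r) + r / 2 * (C * del ^+ 3)).
  by rewrite addr_ge0 ?mulr_ge0 ?subr_ge0 ?addr_ge0 ?exprn_ge0 ?mulr_ge0.
by field.
Qed.

End HeatStep.

(** * Correctors and the one-step estimate *)

Section Poisson.
Context (R : realType) (p : R).
Hypotheses (p_ge0 : 0 <= p) (p_le1 : p <= 1).
Let q := 1 - p.

Let pq_le : p * q <= 4^-1.
Proof.
have : 0 <= (p - 2^-1) ^+ 2 by rewrite sqr_ge0.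
by rewrite /q => ?; lra.
Qed.

Let pq_ge0 : 0 <= p * q. Proof. by rewrite mulr_ge0 ?subr_ge0. Qed.

Let D_neq0 : 1 - p * q != 0.
Proof. by apply/lt0r_neq0; have := pq_le; lra. Qed.

Lemma HS_mean_ge0 : 0 <= HS_mean p.
Proof. by rewrite /HS_mean divr_ge0 // -/q; have := pq_le; lra. Qed.

Lemma HS_mean_le1 : HS_mean p <= 1.
Proof. by rewrite /HS_mean ler_pdivrMr -/q; have := pq_le; lra. Qed.

(** Since [p * q <= 1/4], the numerator is at least [1 - 3/4 - 1/8 = 1/8]. *)
Let var_factor_gt0 : 0 < (1 - 3 * p * q - 2 * p ^+ 2 * q ^+ 2) / (1 - p * q) ^+ 3.
Proof.
rewrite divr_gt0 ?exprn_gt0 //; last by have := pq_le; lra.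
rewrite -mulrA -[2 * _ * _]mulrA -exprMn.
have : (p * q) ^+ 2 <= 4^-1 * 4^-1 by rewrite expr2 ler_pM.
by have := pq_le; lra.
Qed.

Lemma HS_var_ge0 : 0 <= HS_var p.
Proof. by rewrite /HS_var -mulrA -/q mulr_ge0 // ltW. Qed.

(* Solutions of the two Poisson equations [poisson_mean] and [poisson_var] of
   the chain; the value in state [Some c] is written with the probability [r]
   of leaving it, so that no division by [p] or [q] occurs. *)
Definition poisson1 (c : option bool) : R :=
  if c is Some c then (if c then 1 - p else p) ^+ 2 / (1 - p * (1 - p)) else 0.

Definition poisson2 (c : option bool) : R :=
  if c is Some c then
    let r := if c then 1 - p else p in
    let D := 1 - p * (1 - p) in
    (1 - HS_mean p) ^+ 2 / 2
    + (1 - r) ^+ 2 / D * (HS_mean p / 2 - poisson1 (Some c))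
    - (1 - r) * (1 - 3 * p * (1 - p) - 2 * p ^+ 2 * (1 - p) ^+ 2) / (2 * D ^+ 3)
  else 0.

Definition HS_gain (s : nat * option bool) (b : bool) : R :=
  (HS_step s b).1%:R - s.1%:R - HS_mean p.

Lemma HS_gain_le1 s b : `|HS_gain s b| <= 1.
Proof.
have := HS_mean_ge0; have := HS_mean_le1; rewrite /HS_gain ler_norml.
case: s => n [c|] /=; rewrite /HS_step /=; last by rewrite subrr; lra.
by case: eqP => _ /=; rewrite ?subrr -?natr1; lra.
Qed.

(** Averaging over the next bit turns the coefficient of [heat 1] back into the corrector of the
    current state. *)
Lemma poisson_mean s :
  p * (HS_gain s true + poisson1 (HS_step s true).2) +
  (1 - p) * (HS_gain s false + poisson1 (HS_step s false).2) = poisson1 s.2.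
Proof.
case: s => n [[]|]; rewrite /HS_gain /HS_step /= ?subrr -?natr1 /HS_mean; field; exact: D_neq0.
Qed.

(** The same for the coefficient of [heat 2]; here [HS_var] emerges as the variance that the heat
    flow must remove per step. *)
Lemma poisson_var s :
  let term b := HS_gain s b ^+ 2 / 2 +
    poisson1 (HS_step s b).2 * HS_gain s b + poisson2 (HS_step s b).2 - HS_var p / 2 in
  p * term true + (1 - p) * term false = poisson2 s.2.
Proof.
case: s => n [[]|]; rewrite /HS_gain /HS_step /= ?subrr -?natr1 /HS_mean /HS_var /=;
  field; exact: D_neq0.
Qed.

(** For [del = n^(-1/2)] this variance runs from [e + HS_var p] at [k = 0] down to [e] at [k = n],
    compensating the spread of the walk. *)
Let v (e del : R) k := e + HS_var p * (1 - k%:R * del ^+ 2).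
Let y (a del : R) k (x : seq bool) := a - del * ((HS_state x).1%:R - HS_mean p * k%:R).
Let potential e a del k x := corrected_heat del (v e del k) (y a del k x)
  (poisson1 (HS_state x).2) (poisson2 (HS_state x).2).

(** The condition on [k.+1] keeps the variance above [e], where the heat derivatives are uniformly
    bounded. The Poisson equations then identify the averaged main terms with the current
    potential. *)
Lemma potential_step e a : 0 < e -> exists K, forall del k x,
  0 <= del -> del <= 1 -> k.+1%:R * del ^+ 2 <= 1 ->
  `|p * potential e a del k.+1 (rcons x true) +
    (1 - p) * potential e a del k.+1 (rcons x false) - potential e a del k x|
  <= K * del ^+ 3.
Proof.
move=> e0.
have [C0 H0] := heat_bounded 0 e0; have [C1 H1] := heat_bounded 1 e0.
have [C2 H2] := heat_bounded 2 e0; have [C3 H3] := heat_bounded 3 e0.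
pose C := `|C0| + `|C1| + `|C2| + `|C3|.
have HC j w z : (j < 4)%N -> e <= w -> `|heat j.+1 w z| <= C.
  have := normr_ge0 C0; have := normr_ge0 C1; have := normr_ge0 C2; have := normr_ge0 C3.
  case: j => [|[|[|[|//]]]] ? ? ? ? _ ew; [move: (H0 w z ew) (ler_norm C0)
    |move: (H1 w z ew) (ler_norm C1)|move: (H2 w z ew) (ler_norm C2)
    |move: (H3 w z ew) (ler_norm C3)]; rewrite /C; lra.
pose M := `|poisson1 (Some true)| + `|poisson1 (Some false)|
        + `|poisson2 (Some true)| + `|poisson2 (Some false)|.
have HM c : `|poisson1 c| <= M /\ `|poisson2 c| <= M.
  have := normr_ge0 (poisson1 (Some true)); have := normr_ge0 (poisson1 (Some false)).
  have := normr_ge0 (poisson2 (Some true)); have := normr_ge0 (poisson2 (Some false)).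
  by rewrite /M; case: c => [[]|]; rewrite ?normr0; lra.
exists (C * (1 + HS_var p + HS_var p ^+ 2 + 2 * M * (1 + HS_var p))).
move=> del k x del0 del1 kdel.
set s := HS_state x.
pose Q b := heat 0 (v e del k) (y a del k x)
  - del * (HS_gain s b + poisson1 (HS_step s b).2) * heat 1 (v e del k) (y a del k x)
  + del ^+ 2 * (HS_gain s b ^+ 2 / 2 + poisson1 (HS_step s b).2 * HS_gain s b
     + poisson2 (HS_step s b).2 - HS_var p / 2) * heat 2 (v e del k) (y a del k x).
have vS : v e del k.+1 = v e del k - HS_var p * del ^+ 2.
  by rewrite /v -natr1; ring.
have Qb b : `|potential e a del k.+1 (rcons x b) - Q b| <=
    C * (1 + HS_var p + HS_var p ^+ 2 + 2 * M * (1 + HS_var p)) * del ^+ 3.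
  have sb : HS_state (rcons x b) = HS_step s b by rewrite /HS_state foldl_rcons.
  rewrite /potential.
  have -> : y a del k.+1 (rcons x b) = y a del k x - del * HS_gain s b.
    by rewrite /y sb /HS_gain -/s -natr1; ring.
  rewrite sb vS.
  have [M1 M2] := HM (HS_step s b).2.
  apply: (corrected_heat_step e0 HC) => //; first exact: HS_var_ge0.
    by rewrite -vS /v lerDl mulr_ge0 ?HS_var_ge0 ?subr_ge0.
  exact: HS_gain_le1.
have -> : potential e a del k x = p * Q true + (1 - p) * Q false.
  rewrite /potential /corrected_heat -/s -(poisson_mean s) -(poisson_var s) /Q; ring.
set V1 := potential _ _ _ _ (rcons _ true); set V2 := potential _ _ _ _ (rcons _ false).
rewrite (_ : _ - _ = p * (V1 - Q true) + (1 - p) * (V2 - Q false)); last by ring.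
have q0 : 0 <= 1 - p by rewrite subr_ge0.
apply: (le_trans (ler_normD _ _)); rewrite !normrM (ger0_norm p_ge0) (ger0_norm q0).
apply: (le_trans (lerD (ler_wpM2l p_ge0 (Qb true)) (ler_wpM2l q0 (Qb false)))).
by rewrite -mulrDl subrKC mul1r.
Qed.

(** For [k = n] and [del = n^(-1/2)] the accumulated error is [K / sqrt n]. *)
Lemma potential_telescope e a : 0 < e -> exists K, forall del k,
  0 <= del -> del <= 1 -> k%:R * del ^+ 2 <= 1 ->
  `|bits_mean p k (potential e a del k) - potential e a del 0 [::]| <=
    k%:R * (K * del ^+ 3).
Proof.
move=> /(potential_step a)[K HK]; exists K => del k del0 del1.
elim: k => [|k IHk] kdel /=; first by rewrite subrr normr0 mul0r.
have {}IHk := IHk (le_trans _ kdel); rewrite ler_wpM2r ?sqr_ge0 ?ler_nat // in IHk.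
have {}IHk := IHk isT.
rewrite -!bits_meanZ -bits_meanD -natr1 mulrDl mul1r [leRHS]addrC.
rewrite -(subrKA (bits_mean p k (potential e a del k))) (le_trans (ler_normD _ _)) // lerD //.
by apply: ler_bits_mean_dist => // x; exact: HK.
Qed.

Lemma HS_smooth_cvg e a : 0 < e -> exists K, forall n, (0 < n)%N ->
  `|bits_mean p n (fun x => normal_cdf 1 ((Num.sqrt e)^-1 *
      (a - ((HS (butterfly x))%:R - HS_mean p * n%:R) / Num.sqrt n%:R)))
    - normal_cdf 1 ((Num.sqrt (e + HS_var p))^-1 * a)| <= K / Num.sqrt n%:R.
Proof.
move=> e0; have [K HK] := potential_telescope a e0.
have [C0 H0] := heat_bounded 0 e0; have [C1 H1] := heat_bounded 1 e0.
have [M HM] : exists M, forall c, `|poisson1 c| <= M /\ `|poisson2 c| <= M.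
  exists (`|poisson1 (Some true)| + `|poisson1 (Some false)|
        + `|poisson2 (Some true)| + `|poisson2 (Some false)|) => c.
  have := normr_ge0 (poisson1 (Some true)); have := normr_ge0 (poisson1 (Some false)).
  have := normr_ge0 (poisson2 (Some true)); have := normr_ge0 (poisson2 (Some false)).
  by case: c => [[]|]; rewrite ?normr0; lra.
have M0 : 0 <= M by have [+ _] := HM None; rewrite normr0.
exists (K + M * `|C0| + M * `|C1|) => n n0.
pose del : R := (Num.sqrt n%:R)^-1.
have del0 : 0 <= del by rewrite invr_ge0 sqrtr_ge0.
have del2 : n%:R * del ^+ 2 = 1.
  by rewrite exprVn sqr_sqrtr // divff // pnatr_eq0 -lt0n.
have del1 : del <= 1.
  by rewrite invf_le1 ?sqrtr_gt0 ?ltr0n // -[leLHS]sqrtr1 ler_wsqrtr // ler1n.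
have := HK del n del0 del1; rewrite del2 => /(_ (lexx _)).
rewrite mulrCA exprS (mulrCA _ del) del2 mulr1.
(* Both correctors vanish in the initial state [None], so there is no error at time 0. *)
have -> : potential e a del 0 [::] =
    normal_cdf 1 ((Num.sqrt (e + HS_var p))^-1 * a).
  rewrite /potential /corrected_heat /v /y /=.
  by rewrite !(mulr0, mul0r, subr0, addr0, mulr1) /heat expr0 mul1r.
move=> Kdel.
set F := (X in bits_mean p n X).
(* At time [n] the variance is exactly [e], and dropping the correctors costs order [del]. *)
have FV x : `|F x - potential e a del n x| <= (M * `|C0| + M * `|C1|) * del.
  have [g1 g2] := HM (HS_state x).2.
  have ve : v e del n = e by rewrite /v del2 subrr mulr0 addr0.
  have h1 := le_trans (H0 e (y a del n x) (lexx e)) (ler_norm C0).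
  have h2 := le_trans (H1 e (y a del n x) (lexx e)) (ler_norm C1).
  rewrite /potential /corrected_heat ve.
  have -> : heat 0 e (y a del n x) = F x.
    by rewrite /heat expr0 mul1r /F HS_butterflyE /y -/del (mulrC del).
  rewrite (_ : _ - _ = del * (poisson1 (HS_state x).2 * heat 1 e (y a del n x) -
    del * (poisson2 (HS_state x).2 * heat 2 e (y a del n x)))); last by ring.
  rewrite mulrC normrM (ger0_norm del0) ler_wpM2r //.
  rewrite (le_trans (ler_normB _ _)) // lerD //; first by rewrite normrM ler_pM.
  rewrite normrM (ger0_norm del0) -[leRHS]mul1r ler_pM //.
  by rewrite normrM ler_pM.
rewrite -/del -(subrKA (bits_mean p n (potential e a del n))).
rewrite -(addrA K) mulrDl [leRHS]addrC (le_trans (ler_normD _ _)) // lerD //.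
exact: ler_bits_mean_dist.
Qed.

End Poisson.

(** * Passage to the limit *)

Section GaussianLimit.
Context (R : realType).
Implicit Types (a b s x eta del : R).

Lemma normal_cdf_tails eta : 0 < eta -> \forall del \near (0 : R)^'+,
  1 - eta <= normal_cdf 1 del^-1 /\ normal_cdf 1 (- del^-1) <= eta.
Proof.
move=> eta0.
have lt1 : 1 - eta < 1 by rewrite gtrBl.
have [M [_ HM]] := cvgr_gt _ (@cvg_normal_cdfy1 R 1) _ lt1.
have [N [_ HN]] := cvgr_lt _ (@cvg_normal_cdfNy0 R 1) _ eta0.
pose B := `|M| + `|N| + 1.
have B0 : 0 < B by rewrite ltr_pwDr.
have Binv : 0 < B^-1 by rewrite invr_gt0.
near=> del.
have del0 : 0 < del by near: del; exact: nbhs_right_gt.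
have delB : B < del^-1.
  by rewrite -[B]invrK ltf_pV2 ?posrE //; near: del; exact: nbhs_right_lt.
have := ler_norm M; have := ler_norm (- N); rewrite normrN => N1 M1.
have := normr_ge0 M; have := normr_ge0 N => N2 M2.
split; apply/ltW; [apply: HM|apply: HN]; move: delB; rewrite /B; lra.
Unshelve. all: by end_near. Qed.

Lemma normal_cdf_near a s b eta : 0 < s -> 0 < eta ->
  \forall del \near (0 : R)^'+,
  `|normal_cdf 1 ((Num.sqrt s)^-1 * a) -
    normal_cdf 1 ((Num.sqrt (del ^+ 4 + s))^-1 * (a + b * del))| <= eta.
Proof.
move=> s0 eta0.
have c1 : (Num.sqrt (del ^+ 4 + s))^-1 * (a + b * del) @[del --> (0 : R)^'+] -->
    (Num.sqrt s)^-1 * a.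
  apply: cvg_at_right_filter.
  rewrite -[X in _ --> X](_ : (Num.sqrt (0 ^+ 4 + s))^-1 * (a + b * 0) = _); last first.
    by rewrite expr0n /= add0r mulr0 addr0.
  apply: cvgM.
    apply: cvgV; first by rewrite expr0n add0r sqrtr_eq0 -ltNge.
    apply: (cvg_comp (fun del : R => del ^+ 4 + s)); last exact: sqrt_continuous.
    by apply: cvgD; [exact: exprn_continuous|exact: cvg_cst].
  apply: cvgD; first exact: cvg_cst.
  by apply: cvgM; [exact: cvg_cst|exact: cvg_id].
have c2 : {for (Num.sqrt s)^-1 * a, continuous (@normal_cdf R 1)}.
  have [d _] := is_derive_normal_cdf ((Num.sqrt s)^-1 * a) (oner_neq0 R).
  by apply/differentiable_continuous/derivable1_diffP.
exact: (cvgr_dist_le _ _ (cvg_comp _ _ c1 c2) _ eta0).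
Qed.

Lemma gaussian_cdf_degenerate x :
  gaussian (0 : R) 0 `]-oo, x]%classic = (if 0 <= x then 1 else 0)%:E.
Proof.
rewrite /gaussian eqxx /= diracE; case: ifPn => x0.
  by rewrite mem_set //= in_itv.
by rewrite memNset //= in_itv /= => h; rewrite h in x0.
Qed.

Lemma gaussian_cdf_gt0 s x : 0 < s ->
  gaussian 0 s `]-oo, x]%classic = (normal_cdf 1 ((Num.sqrt s)^-1 * x))%:E.
Proof.
move=> s0; rewrite /gaussian gt_eqF //= -normal_cdfE.
by rewrite (@normal_cdf_scale R) ?sqrtr_gt0 // mulrC.
Qed.

(** For [s = 0] the argument of [normal_cdf] is [(a + b * del) / del ^+ 2]. Its sign is that of [a]
    and its modulus is at least [1 / del] once [del < |a| / 2], so the tail bounds suffice. *)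
Lemma gaussian_cdf_near a s b eta : 0 <= s -> 0 < eta -> `|b| <= 1 ->
  {for a, continuous (fun x => gaussian 0 s `]-oo, x]%classic)} ->
  \forall del \near (0 : R)^'+,
  `|fine (gaussian 0 s `]-oo, a]%classic) -
    normal_cdf 1 ((Num.sqrt (del ^+ 4 + s))^-1 * (a + b * del))| <= eta.
Proof.
rewrite le_eqVlt => /orP[/eqP <-|s0] eta0 b1 ca; last first.
  by rewrite gaussian_cdf_gt0 //=; exact: normal_cdf_near.
(* The distribution function of the point mass jumps at 0, so 0 is not a continuity point. *)
have a0 : a != 0.
  apply/eqP => a0; move: ca; rewrite a0 /prop_for /continuous_at.
  rewrite gaussian_cdf_degenerate lexx => /fine_cvg c.
  have [e /= e0 He] := cvgr_gt _ c _ (ltr01 (R := R)).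
  have e2 : 0 < e / 2 by rewrite divr_gt0.
  have : ball_ Num.norm 0 e (- (e / 2)).
    by rewrite /ball_ /= sub0r opprK gtr0_norm // gtr_pMr // invf_lt1 // ltr1n.
  by move=> /He /=; rewrite gaussian_cdf_degenerate oppr_ge0 leNgt e2 ltxx.
near=> del.
have del0 : 0 < del by near: del; exact: nbhs_right_gt.
have dela : del < `|a| / 2.
  by near: del; apply: nbhs_right_lt; rewrite divr_gt0 ?normr_gt0.
have [t1 t2] : 1 - eta <= normal_cdf 1 del^-1 /\ normal_cdf 1 (- del^-1) <= eta.
  by near: del; exact: normal_cdf_tails.
have del1 : del < 1 by near: del; exact: nbhs_right_lt.
have -> : (Num.sqrt (del ^+ 4 + 0))^-1 = del^-1 ^+ 2.
  rewrite addr0 (_ : del ^+ 4 = (del ^+ 2) ^+ 2); last by rewrite -exprM.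
  by rewrite sqrtr_sqr ger0_norm ?exprn_ge0 ?ltW // exprVn.
have di : 0 < del^-1 by rewrite invr_gt0.
have bd : `|b * del| <= del.
  by rewrite normrM (gtr0_norm del0) ler_piMl // ltW.
move: bd; rewrite ler_norml => /andP[bd1 bd2].
rewrite gaussian_cdf_degenerate; case: ifPn => /= a1.
  move: dela; rewrite ger0_norm // => dela.
  rewrite ger0_norm ?subr_ge0 ?normal_cdf_le1 //.
  rewrite lerBlDl -lerBlDr (le_trans t1) //; apply: normal_cdf_ndecr.
  rewrite expr2 -mulrA -[leLHS]mulr1 ler_pM2l // mulrC ler_pdivlMr // mul1r; lra.
rewrite -ltNge in a1; move: dela; rewrite ltr0_norm // => dela.
rewrite sub0r normrN ger0_norm ?normal_cdf_ge0 //.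
apply: (le_trans _ t2); apply: normal_cdf_ndecr.
rewrite -[leRHS]mulrN1 expr2 -mulrA ler_pM2l // mulrC ler_pdivrMr //; lra.
Unshelve. all: by end_near. Qed.

End GaussianLimit.

Unset Implicit Arguments.
Set Strict Implicit.

Theorem corollary2 (R : realType) (d : measure_display) (T : measurableType d)
    (P : probability T R) (p : R) (X : nat -> {RV P >-> bool})
    (p_ge0 : 0 <= p) (p_le1 : p <= 1)
    (X_bernoulli : forall j : nat, distribution P (X j) =1 bernoulli_prob p)
    (X_indep : independent_RVs P X) :
  cvg_in_distribution P (fun n => HS_normalized X (HS_mean p) n)
    (gaussian 0 (HS_var p)).
Proof.
move=> /= a ca.
pose W n x := ((HS (butterfly x))%:R - HS_mean p * n%:R) / Num.sqrt n%:R : R.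
have cdfE n : cdf (P := P) (HS_normalized X (HS_mean p) n) a =
    (bits_mean p n (fun x => (W n x <= a)%R%:R))%:E.
  have E : HS_normalized X (HS_mean p) n @^-1` `]-oo, a]%classic =
      [set w | W n (mkseq (fun j => X j w) n) <= a].
    by apply/seteqP; split=> w /=; rewrite in_itv.
  rewrite /cdf /distribution /pushforward /= E.
  exact: (probability_bits p_ge0 p_le1 X_bernoulli X_indep n (fun x => W n x <= a)).
rewrite (eq_cvg _ _ cdfE).
have -> : gaussian 0 (HS_var p) `]-oo, a]%classic =
    (fine (gaussian 0 (HS_var p) `]-oo, a]%classic))%:E.
  by rewrite fineK // fin_num_measure.
apply: cvg_EFin; first by near=> n.
apply/cvgrPdist_le => eta eta0.
have eta3 : 0 < eta / 3 by rewrite divr_gt0.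
(* The smoothing width is fixed before [n]. The error budget is one third each for the tails, the
   smoothed limit and the rate in [n]. *)
have [del [del0 [t1 t2] [u1 u2]]] : exists del : R, [/\ 0 < del,
    1 - eta / 3 <= normal_cdf 1 del^-1 /\ normal_cdf 1 (- del^-1) <= eta / 3 &
    `|fine (gaussian 0 (HS_var p) `]-oo, a]%classic) -
      normal_cdf 1 ((Num.sqrt (del ^+ 4 + HS_var p))^-1 * (a + 1 * del))| <= eta / 3 /\
    `|fine (gaussian 0 (HS_var p) `]-oo, a]%classic) -
      normal_cdf 1 ((Num.sqrt (del ^+ 4 + HS_var p))^-1 * (a + -1 * del))| <= eta / 3].
  have v0 := HS_var_ge0 p_ge0 p_le1.
  apply: (@filter_ex _ (0 : R)^'+); near=> del; split.
  - by near: del; exact: nbhs_right_gt.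
  - by near: del; exact: normal_cdf_tails.
  - split; near: del; apply: gaussian_cdf_near => //; rewrite ?normrN normr1 //.
have e0 : 0 < del ^+ 4 by rewrite exprn_gt0.
have [K1 H1] := HS_smooth_cvg p_ge0 p_le1 (a + 1 * del) e0.
have [K2 H2] := HS_smooth_cvg p_ge0 p_le1 (a + -1 * del) e0.
have se : (Num.sqrt (del ^+ 4))^-1 = del^-1 ^+ 2.
  rewrite (_ : del ^+ 4 = (del ^+ 2) ^+ 2); last by rewrite -exprM.
  by rewrite sqrtr_sqr ger0_norm ?exprn_ge0 ?ltW // exprVn.
(* If [W n x <= a], the shift by [del] makes the argument at least [del / del ^+ 2 = 1 / del], where
   the tail bound applies; [lower] is symmetric. *)
have upper n x : (W n x <= a)%R%:R <=
    normal_cdf 1 ((Num.sqrt (del ^+ 4))^-1 * (a + 1 * del - W n x)) + eta / 3 :> R.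
  have [Wa|_] /= := leP (W n x) a; last first.
    by rewrite addr_ge0 ?normal_cdf_ge0 // ltW.
  rewrite -lerBlDr (le_trans t1) //; apply: normal_cdf_ndecr.
  rewrite se expr2 -mulrA -[leLHS]mulr1 ler_pM2l ?invr_gt0 //.
  by rewrite mulrC ler_pdivlMr //; lra.
have lower n x : normal_cdf 1 ((Num.sqrt (del ^+ 4))^-1 * (a + -1 * del - W n x)) +
    - (eta / 3) <= (W n x <= a)%R%:R :> R.
  have [_|Wa] /= := leP (W n x) a.
    by have := normal_cdf_le1 1 ((Num.sqrt (del ^+ 4))^-1 * (a + -1 * del - W n x)); lra.
  rewrite subr_le0; apply: (le_trans _ t2); apply: normal_cdf_ndecr.
  rewrite se expr2 -mulrA -[leRHS]mulrN1 ler_pM2l ?invr_gt0 //.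
  by rewrite mulrC ler_pdivrMr //; lra.
(* Once [sqrt n >= B], both rates [K1 / sqrt n] and [K2 / sqrt n] are at most [eta / 3]. *)
pose B := (`|K1| + `|K2|) / (eta / 3).
have B0 : 0 <= B by rewrite divr_ge0 ?addr_ge0 // ltW.
near=> n.
have n0 : (0 < n)%N by near: n; exact: nbhs_infty_gt.
have sB : B <= Num.sqrt n%:R.
  rewrite -[leLHS]ger0_norm // -sqrtr_sqr ler_wsqrtr //.
  by near: n; exact: nbhs_infty_ger.
have small K : K <= `|K1| + `|K2| -> K / Num.sqrt n%:R <= eta / 3.
  move=> KB; rewrite ler_pdivrMr ?sqrtr_gt0 ?ltr0n //.
  by rewrite mulrC -ler_pdivrMr // (le_trans _ sB) // ler_pM2r ?invr_gt0.
have := le_trans (H1 n n0) (small K1 (ler_wpDr (normr_ge0 K2) (ler_norm K1))).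
have := le_trans (H2 n n0) (small K2 (ler_wpDl (normr_ge0 K1) (ler_norm K2))).
have := ler_bits_mean p_ge0 p_le1 n (upper n).
have := ler_bits_mean p_ge0 p_le1 n (lower n).
rewrite !bits_meanD !bits_mean_cst -/(W n).
set lo := bits_mean p n (fun x => normal_cdf 1 (_ * (a + -1 * del - _))).
set up := bits_mean p n (fun x => normal_cdf 1 (_ * (a + 1 * del - _))).
rewrite [(fine \o _) n]/=; set b := bits_mean p n (fun x => _%:R).
move: u1 u2; rewrite !ler_norml.
by move=> /andP[? ?] /andP[? ?] ? ? /andP[? ?] /andP[? ?]; apply/andP; split; lra.
Unshelve. all: by end_near. Qed.
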